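(* Let $(\mathbb{Z},\boldsymbol{\preccurlyeq})$ be a random shift-invariant rooted permutation. Then the sequence of random permutations $(\boldsymbol{\sigma}^n)_{n\in\mathbb{Z}_{>0}}$ defined, for all $n\in\mathbb{Z}_{>0}$, by $$\mathbb{P}(\boldsymbol{\sigma}^n=\rho)=\mathbb{P}\big((\mathbb{Z},\boldsymbol{\preccurlyeq})\in O(\rho^{-1})\big),\quad\text{for all }\rho\in\mathcal{S}^n,$$ (rooted at a uniform random index $\boldsymbol{i}_n$ in $[n]$, independent of $\boldsymbol{\sigma}^n$) converges in the annealed Benjamini--Schramm sense to $(\mathbb{Z},\boldsymbol{\preccurlyeq})$, i.e. $(\boldsymbol{\sigma}^n,\boldsymbol{i}_n)\to(\mathbb{Z},\boldsymbol{\preccurlyeq})$ in distribution with respect to the local distance $d$.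
   Context: All intervals $[a,b]$ are integer intervals. $\mathcal{S}^n$ is the set of permutations $\sigma=\sigma_1\cdots\sigma_n$ of $[n]=\{1,\dots,n\}$, $|\sigma|=n$ is the size, and $\mathcal{S}=\bigcup_{n\ge1}\mathcal{S}^n$. Rooted permutations. A finite rooted permutation is a pair $(\sigma,i)$ with $\sigma\in\mathcal{S}^n$, $i\in[n]$. It is identified with the pair $(A_{\sigma,i},\preccurlyeq_{\sigma,i})$, where $A_{\sigma,i}=[-i+1,|\sigma|-i]$ and $\preccurlyeq_{\sigma,i}$ is the total order on it given by $\ell\preccurlyeq_{\sigma,i}j\iff\sigma_{\ell+i}\le\sigma_{j+i}$; this is a bijection between finite rooted permutations and total orders on finite integer intervals containing $0$. An infinite rooted permutation is a pair $(A,\preccurlyeq)$ with $A$ an infinite integer interval containing $0$ and $\preccurlyeq$ a total order on $A$. $\tilde{\mathcal{S}}_\bullet$ is the set of all finite and infinite rooted permutations. For $h\in\mathbb{Z}_{>0}$, $r_h(A,\preccurlyeq)=(A\cap[-h,h],\preccurlyeq)$. The local distance on $\tilde{\mathcal{S}}_\bullet$ is $d(x,y)=2^{-\sup\{h\in\mathbb{Z}_{>0}:\,r_h(x)=r_h(y)\}}$, with $\sup\emptyset=0$, $\sup\mathbb{Z}_{>0}=+\infty$, $2^{-\infty}=0$. Shift-invariance: for $\pi\in\mathcal{S}^k$ and $s\in\mathbb{Z}$ let $O^s(\pi)=\{(A,\preccurlyeq)\in\tilde{\mathcal{S}}_\bullet:[1+s,k+s]\subseteq A\text{ and }\pi_1+s\preccurlyeq\pi_2+s\preccurlyeq\cdots\preccurlyeq\pi_k+s\}$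 and $O(\pi)=O^0(\pi)$. A random rooted permutation $(\boldsymbol{A},\boldsymbol{\preccurlyeq})$ with values in $\tilde{\mathcal{S}}_\bullet$ is shift-invariant if $\mathbb{P}((\boldsymbol{A},\boldsymbol{\preccurlyeq})\in O^s(\pi))=\mathbb{P}((\boldsymbol{A},\boldsymbol{\preccurlyeq})\in O(\pi))$ for all $\pi\in\mathcal{S}$ and all $s\in\mathbb{Z}$. *)

(* Defs.v *)
From HB Require Import structures.
From mathcomp Require Import all_boot all_order all_fingroup all_algebra.
From mathcomp Require Import all_classical all_reals all_analysis.
From mathcomp Require Import zify.

Set Implicit Arguments.
Unset Strict Implicit.
Unset Printing Implicit Defensive.

Import Order.TTheory GRing.Theory Num.Theory.
Import numFieldNormedType.Exports.

Local Open Scope classical_set_scope.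
Local Open Scope ring_scope.

(* A finite or infinite rooted permutation (A, <=): an integer interval A
   containing 0 and a total order on A. The order is a relation on [int] that
   vanishes outside A ([rp_le_dom]), so that Leibniz equality of records is
   equality of pairs. *)
Record rooted_perm := RootedPerm {
  rp_dom : set int;
  rp_le : int -> int -> Prop;
  rp_itv : is_interval rp_dom;
  rp_dom0 : rp_dom 0;
  rp_le_dom : forall l j, rp_le l j -> rp_dom l /\ rp_dom j;
  rp_le_total : forall l j, rp_dom l -> rp_dom j -> rp_le l j \/ rp_le j l;
  rp_le_anti : forall l j, rp_le l j -> rp_le j l -> l = j;
  rp_le_trans : forall j l m, rp_le l j -> rp_le j m -> rp_le l m
}.

Lemma rooted_permP (x y : rooted_perm) :
  rp_dom x = rp_dom y -> rp_le x = rp_le y -> x = y.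
Proof.
case: x y => [A r a b c d e f] [A' r' a' b' c' d' e' f'] /= EA Er.
by subst; f_equal; exact: Prop_irrelevance.
Qed.

Section of_perm.
Context (n : nat) (sigma : 'S_n) (i : 'I_n).

(* 0-based encoding: (sigma_1 ... sigma_n, r) with sigma_(k.+1) = (sigma k).+1
   and root r = i.+1, so that the domain is [- r + 1, n - r]. *)
Definition of_perm_dom : set int :=
  [set l | - (i : nat)%:Z <= l <= n%:Z - i.+1%:Z].

Definition of_perm_le (l j : int) : Prop :=
  exists a b : 'I_n, [/\ l + (i : nat)%:Z = (a : nat)%:Z,
    j + (i : nat)%:Z = (b : nat)%:Z & (sigma a <= sigma b)%N].

Lemma of_perm_domP l :
  of_perm_dom l <-> exists a : 'I_n, l + (i : nat)%:Z = (a : nat)%:Z.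
Proof.
rewrite /of_perm_dom /=; split=> [/andP[il ln]|[a la]].
  case E : (l + (i : nat)%:Z) => [m|m]; last by lia.
  have mn : (m < n)%N by lia.
  by exists (Ordinal mn).
by have := ltn_ord a; lia.
Qed.

Lemma of_perm_itv : is_interval of_perm_dom.
Proof.
move=> x y /andP[ix _] /andP[_ yn] z /andP[xz zy].
by apply/andP; split; [exact: le_trans xz|exact: le_trans yn].
Qed.

Lemma of_perm_dom0 : of_perm_dom 0.
Proof. by apply/of_perm_domP; exists i; rewrite add0r. Qed.

Lemma of_perm_le_dom l j : of_perm_le l j -> of_perm_dom l /\ of_perm_dom j.
Proof.
by move=> [a [b [la jb _]]]; split; apply/of_perm_domP; [exists a|exists b].
Qed.

Lemma of_perm_le_total l j : of_perm_dom l -> of_perm_dom j ->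
  of_perm_le l j \/ of_perm_le j l.
Proof.
move=> /of_perm_domP[a la] /of_perm_domP[b jb].
by case/orP: (leq_total (sigma a) (sigma b)) => ab;
  [left; exists a, b|right; exists b, a].
Qed.

Lemma of_perm_le_anti l j : of_perm_le l j -> of_perm_le j l -> l = j.
Proof.
move=> [a [b [la jb ab]]] [b' [a' [jb' la' ba]]].
have ea : a' = a by apply/val_inj/eqP; rewrite -eqz_nat -la -la'.
have eb : b' = b by apply/val_inj/eqP; rewrite -eqz_nat -jb -jb'.
apply: (addIr (i : nat)%:Z); rewrite la jb; congr (Posz (val _)).
by apply: (@perm_inj _ sigma); apply/val_inj/eqP; rewrite eqn_leq ab -ea -eb.
Qed.

Lemma of_perm_le_trans j l m :
  of_perm_le l j -> of_perm_le j m -> of_perm_le l m.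
Proof.
move=> [a [b [la jb ab]]] [b' [c [jb' mc bc]]]; exists a, c; split=> //.
have eb : b' = b by apply/val_inj/eqP; rewrite -eqz_nat -jb -jb'.
by rewrite (leq_trans ab)// -eb.
Qed.

Definition of_perm : rooted_perm :=
  RootedPerm of_perm_itv of_perm_dom0 of_perm_le_dom of_perm_le_total
    of_perm_le_anti of_perm_le_trans.

End of_perm.

Section restriction.
Context (h : nat) (x : rooted_perm).

Definition restr_dom : set int := rp_dom x `&` [set l | - h%:Z <= l <= h%:Z].

Definition restr_le (l j : int) : Prop :=
  [/\ restr_dom l, restr_dom j & rp_le x l j].

Lemma restr_itv : is_interval restr_dom.
Proof.
move=> a b [xa /andP[ha _]] [xb /andP[_ bh]] z /andP[az zb].
split; first by apply: (rp_itv xa xb); rewrite az.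
by apply/andP; split; [exact: le_trans az|exact: le_trans bh].
Qed.

Lemma restr_dom0 : restr_dom 0.
Proof. by split; [exact: rp_dom0|rewrite /= oppr_le0]. Qed.

Lemma restr_le_dom l j : restr_le l j -> restr_dom l /\ restr_dom j.
Proof. by case. Qed.

Lemma restr_le_total l j : restr_dom l -> restr_dom j ->
  restr_le l j \/ restr_le j l.
Proof.
move=> xl xj; case: (rp_le_total (proj1 xl) (proj1 xj)) => lj.
  by left; split.
by right; split.
Qed.

Lemma restr_le_anti l j : restr_le l j -> restr_le j l -> l = j.
Proof. by move=> [_ _ lj] [_ _ jl]; exact: rp_le_anti lj jl. Qed.

Lemma restr_le_trans j l m : restr_le l j -> restr_le j m -> restr_le l m.
Proof.
by move=> [xl _ lj] [_ xm jm]; split=> //; exact: rp_le_trans lj jm.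
Qed.

Definition restr : rooted_perm :=
  RootedPerm restr_itv restr_dom0 restr_le_dom restr_le_total
    restr_le_anti restr_le_trans.

End restriction.

Lemma restr_restr (h k : nat) x : (k <= h)%N -> restr k (restr h x) = restr k x.
Proof.
move=> kh.
have E : restr_dom k (restr h x) = restr_dom k x.
  apply/seteqP; split=> [l [[xl _] kl]|l [xl kl]]; split=> //; split=> //=.
  case/andP: kl => kl lk; apply/andP; split.
    by rewrite (le_trans _ kl)// lerN2 lez_nat.
  by rewrite (le_trans lk)// lez_nat.
apply: rooted_permP => //=.
apply/funext => l; apply/funext => j; apply/propext; rewrite /restr_le E.
split=> [[xl xj [_ _ lj]]//|[xl xj lj]].
split=> //; split=> //=; first by move: xl; rewrite -E => -[].
by move: xj; rewrite -E => -[].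
Qed.

Lemma restr_eq (h k : nat) x y :
  (k <= h)%N -> restr h x = restr h y -> restr k x = restr k y.
Proof. by move=> kh xy; rewrite -(restr_restr x kh) xy restr_restr. Qed.

Lemma restr_inj x y :
  (forall h, (0 < h)%N -> restr h x = restr h y) -> x = y.
Proof.
move=> xy.
have in_restr (l : int) h : (`|l| <= h)%N -> - h%:Z <= l <= h%:Z.
  by move=> lh; rewrite -ler_norml -abszE lez_nat.
have dom_sub u v : (forall h, (0 < h)%N -> restr h u = restr h v) ->
    rp_dom u `<=` rp_dom v.
  move=> uv l ul; have /(congr1 rp_dom)/= E := uv _ (ltn0Sn `|l|%N).
  have : restr_dom `|l|.+1 u l by split=> //; exact: in_restr.
  by rewrite E => -[].
have le_sub u v : (forall h, (0 < h)%N -> restr h u = restr h v) ->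
    forall l j, rp_le u l j -> rp_le v l j.
  move=> uv l j lj.
  have /(congr1 rp_le)/= E := uv _ (ltn0Sn (`|l| + `|j|)%N).
  have [ul uj] := rp_le_dom lj.
  have : restr_le (`|l| + `|j|).+1 u l j.
    split=> //; split=> //; apply: in_restr.
      by rewrite leqW// leq_addr.
    by rewrite leqW// leq_addl.
  by rewrite E => -[].
have yx h : (0 < h)%N -> restr h y = restr h x by move=> /xy.
apply: rooted_permP; first by apply/seteqP; split; exact: dom_sub.
apply/funext => l; apply/funext => j; apply/propext; split; exact: le_sub.
Qed.

Section local_distance.
Context (R : realType).
Implicit Types x y z : rooted_perm.

(* Adding 0 implements the convention [sup set0 = 0]. *)
Definition agreement x y : \bar R :=
  ereal_sup (0%E |`
    [set h%:R%:E | h in [set h : nat | (0 < h)%N /\ restr h x = restr h y]]).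

(* [agreement x y] is never [-oo], so the default branch is [2 ^ (- +oo) = 0]. *)
Definition local_dist x y : R :=
  if agreement x y is s%:E then 2 `^ (- s) else 0.

Lemma agreement_ge0 x y : (0 <= agreement x y)%E.
Proof. by apply: ereal_sup_ubound; left. Qed.

Lemma agreement_sym x y : agreement x y = agreement y x.
Proof.
congr (ereal_sup (_ |` _)); apply/seteqP.
by split=> _ [h [h0 E] <-]; exists h.
Qed.

Lemma agreement_restr x y (h : nat) : (h%:R%:E < agreement x y)%E ->
  restr h x = restr h y.
Proof.
move=> /ereal_sup_gt[_ [->|[k [k0 E] <-]]]; first by rewrite lte_fin ltrn0.
by rewrite lte_fin ltr_nat => /ltnW hk; exact: restr_eq E.
Qed.

Lemma agreement_triangle y x z :
  (Order.min (agreement x y) (agreement y z) <= agreement x z)%E.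
Proof.
rewrite leNgt; apply/negP; rewrite lt_min => /andP[].
move=> /ereal_sup_gt[_ [->|[h [h0 xy] <-]]].
  by move=> /lt_geF; rewrite agreement_ge0.
move=> hxz /ereal_sup_gt[_ [->|[k [k0 yz] <-]]].
  by move=> /lt_geF; rewrite agreement_ge0.
move=> kxz; have : ((minn h k)%:R%:E <= agreement x z)%E.
  apply: ereal_sup_ubound; right; exists (minn h k) => //; split.
    by rewrite leq_min h0.
  by rewrite (restr_eq (geq_minl h k) xy) (restr_eq (geq_minr h k) yz).
by rewrite leNgt /minn; case: ifP => _; rewrite ?hxz ?kxz.
Qed.

Lemma local_distxx x : local_dist x x = 0.
Proof.
suff : agreement x x = +oo%E by rewrite /local_dist => ->.
apply/eqyP => r r0; set h := (Num.truncn r).+1.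
apply: (@le_trans _ _ h%:R%:E).
  by rewrite lee_fin ltW// truncnS_gt.
by apply: ereal_sup_ubound; right; exists h.
Qed.

Lemma local_dist_ge0 x y : 0 <= local_dist x y.
Proof. by rewrite /local_dist; case: (agreement x y) => // s; exact: powR_ge0. Qed.

Lemma local_dist_eq0 x y : local_dist x y = 0 -> x = y.
Proof.
rewrite /local_dist; have := agreement_ge0 x y.
case E : (agreement x y) => [s| |//] _.
  by move=> /eqP; rewrite gt_eqF// powR_gt0.
by move=> _; apply: restr_inj => h _; apply: agreement_restr; rewrite E ltry.
Qed.

Lemma local_dist_sym x y : local_dist x y = local_dist y x.
Proof. by rewrite /local_dist agreement_sym. Qed.

Lemma local_dist_le x y x' y' :
  (agreement x' y' <= agreement x y)%E -> local_dist x y <= local_dist x' y'.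
Proof.
rewrite /local_dist; have := agreement_ge0 x y; have := agreement_ge0 x' y'.
case: (agreement x y) => [s| |]; case: (agreement x' y') => [t| |] //.
  by rewrite !lee_fin => _ _ ts; rewrite ler_powR ?lerN2// ler1n.
Qed.

Lemma local_dist_triangle y x z :
  local_dist x z <= local_dist x y + local_dist y z.
Proof.
have := agreement_triangle y x z; rewrite ge_min => /orP[] /local_dist_le le.
  by rewrite (le_trans le)// lerDl local_dist_ge0.
by rewrite (le_trans le)// lerDr local_dist_ge0.
Qed.

End local_distance.

(* The metric space of rooted permutations; the index [R] only records the
   field in which the distance takes its values. *)
Definition rperm (R : realType) : Type := rooted_perm.

Section rperm_instances.
Context (R : realType).

HB.instance Definition _ := gen_eqMixin (rperm R).
HB.instance Definition _ := gen_choiceMixin (rperm R).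
HB.instance Definition _ :=
  isPointed.Build (rperm R) (of_perm (1%g : 'S_1) ord0).
HB.instance Definition _ := isMetric.Build R (rperm R)
  (@local_distxx R) (@local_dist_eq0 R) (@local_dist_sym R)
  (@local_dist_triangle R).

End rperm_instances.

Notation borel_rperm R := (g_sigma_algebraType (@open (rperm R))).

(* 0-based encoding: pi_(a.+1) = (pi a).+1; the chain of inequalities is
   written between consecutive entries. *)
Definition shifted_pattern (s : int) (k : nat) (pi : 'S_k) : set rooted_perm :=
  [set x | [set l : int | 1 + s <= l <= k%:Z + s] `<=` rp_dom x /\
    forall a b : 'I_k, b = a.+1 :> nat ->
      rp_le x ((pi a).+1%:Z + s) ((pi b).+1%:Z + s)].

Definition pattern (k : nat) (pi : 'S_k) : set rooted_perm :=
  shifted_pattern 0 pi.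

Section random.
Context (R : realType) (d : measure_display) (Omega : measurableType d).
Variable P : probability Omega R.

Definition shift_invariant (X : Omega -> rooted_perm) : Prop :=
  forall (k : nat) (pi : 'S_k) (s : int), (0 < k)%N ->
    P (X @^-1` shifted_pattern s pi) = P (X @^-1` pattern pi).

Definition discrete_measurable_fun (T : Type) (X : Omega -> T) : Prop :=
  forall A : set T, measurable (X @^-1` A).

Definition discrete_independent (T U : Type)
    (X : Omega -> T) (Y : Omega -> U) : Prop :=
  forall (A : set T) (B : set U),
    P (X @^-1` A `&` Y @^-1` B) = (P (X @^-1` A) * P (Y @^-1` B))%E.

Definition uniform_index (n : nat) (i : Omega -> 'I_n) : Prop :=
  forall j : 'I_n, P (i @^-1` [set j]) = (n%:R^-1)%:E.

End random.

Definition cvg_in_distribution (R : realType) (T : topologicalType)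
    (d : nat -> measure_display) (Omega : forall n, measurableType (d n))
    (P : forall n, probability (Omega n) R) (X : forall n, Omega n -> T)
    (d' : measure_display) (Omega' : measurableType d')
    (Q : probability Omega' R) (Y : Omega' -> T) : Prop :=
  forall f : T -> R, continuous f -> [bounded f x | x in [set: T]] ->
    'E_(P n)[f \o X n]%E @[n --> \oo] --> 'E_Q[f \o Y]%E.

(* [sigma n] is a permutation of size [n.+1]. *)
Definition annealed_BS_cvg (R : realType)
    (d : nat -> measure_display) (Omega : forall n, measurableType (d n))
    (P : forall n, probability (Omega n) R)
    (sigma : forall n, Omega n -> 'S_n.+1) (i : forall n, Omega n -> 'I_n.+1)
    (d' : measure_display) (Omega' : measurableType d')
    (Q : probability Omega' R) (X : Omega' -> rperm R) : Prop :=
  @cvg_in_distribution R (rperm R) d Omega P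
    (fun n w => of_perm (sigma n w) (i n w)) d' Omega' Q X.

(* Main.v *)
Require Import Defs.
From HB Require Import structures.
From mathcomp Require Import all_boot all_order all_fingroup all_algebra.
From mathcomp Require Import all_classical all_reals all_analysis.
From mathcomp Require Import measurable_realfun zify lra.
Import Order.TTheory GRing.Theory Num.Theory.
Import numFieldNormedType.Exports.
Local Open Scope classical_set_scope.
Local Open Scope ring_scope.

(* By shift-invariance, the permutation that sorts X on the window [-j, n - j]
   has the same law for every j, namely that of the random permutation of size
   n + 1. Hence the expectation of f at the uniformly rooted permutation is the
   average over j of the expectations of f at X restricted to [-j, n - j]. When
   j and n - j tend to infinity these restrictions converge to X pointwise, so
   by dominated convergence their expectations are uniformly close to E[f(X)]
   for all roots far enough from both ends: otherwise they would stay away from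
   it along a sequence of windows exhausting Z. The remaining roots are a
   vanishing proportion. *)

Set Implicit Arguments.
Unset Strict Implicit.
Unset Printing Implicit Defensive.

(** * Total orders on finite sets as permutations *)

Lemma card_ord_ltn (k m : nat) : (m <= k)%N ->
  #|[set c : 'I_k | (c < m)%N]%SET| = m.
Proof.
move=> mk; rewrite cardsE -sum1_card -[RHS]card_ord -sum1_card.
by rewrite (big_ord_widen k (fun=> 1%N) mk).
Qed.

Lemma card_perm_lt (k : nat) (rho : 'S_k) (a : 'I_k) :
  #|[set b : 'I_k | (rho b < rho a)%N]%SET| = rho a.
Proof.
rewrite -[RHS](@card_ord_ltn k) ?(ltnW (ltn_ord _))//.
rewrite -(card_imset _ (@perm_inj _ rho)); apply: fintype.eq_card => c.
rewrite inE; apply/imsetP/idP => [[b]|ca]; first by rewrite inE => ? ->.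
by exists ((rho^-1)%g c); rewrite ?inE permKV.
Qed.

(** With 0-based values, each entry is the number of smaller entries, so comparisons determine all
    values. *)
Lemma eq_perm_le (k : nat) (rho tau : 'S_k) :
  (forall a b, (rho a <= rho b)%N = (tau a <= tau b)%N) -> rho = tau.
Proof.
move=> E; apply/permP => a; apply: val_inj; rewrite /= -[LHS]card_perm_lt -[RHS]card_perm_lt.
by apply: fintype.eq_card => b; rewrite !inE !ltnNge E.
Qed.

(** The permutation is the rank function: [a] goes to the number of elements strictly below it. Rank
    strictly increases along the order, hence is injective. *)
Lemma total_order_perm (k : nat) (le : rel 'I_k) :
  total le -> antisymmetric le -> transitive le ->
  exists rho : 'S_k, forall a b, le a b = (rho a <= rho b)%N.
Proof.
move=> le_total le_anti le_trans.
pose below a := [set b | le b a && (b != a)]%SET.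
have le_refl a : le a a by have := le_total a a; rewrite orbb.
have below_lt a : (#|below a| < k)%N.
  rewrite -[X in (_ < X)%N]card_ord -cardsT; apply: proper_card.
  by apply/properP; split; [exact: finset.subsetT|exists a; rewrite !inE// le_refl eqxx].
have below_sub a b : le a b -> a != b -> (#|below a| < #|below b|)%N.
  move=> ab ab'; apply: proper_card; apply/properP; split; last first.
    by exists a; rewrite !inE ?ab ?ab'// eqxx andbF.
  apply/fintype.subsetP => c; rewrite !inE => /andP[ca ca'].
  rewrite (le_trans _ _ _ ca ab)/=; apply/eqP => cb; subst c.
  by move/eqP: ca'; apply; apply: le_anti; rewrite ca ab.
have rank_inj : injective (fun a => Ordinal (below_lt a)).
  move=> a b /(congr1 val)/= ab; apply/eqP/negPn/negP => ab'.
  by have [/below_sub/(_ ab')|] := orP (le_total a b);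
    [|move/below_sub; rewrite eq_sym => /(_ ab')]; rewrite ab ltnn.
exists (perm rank_inj) => a b; rewrite !permE/=.
have [->|ab] := eqVneq a b; first by rewrite le_refl leqnn.
have [leab|/negP nab] := boolP (le a b); first by rewrite ltnW// below_sub.
have ba : le b a by have [|//] := orP (le_total a b).
by apply/esym/negbTE; rewrite -ltnNge below_sub// eq_sym.
Qed.

(** * Patterns of a rooted permutation on a window *)

Lemma rp_le_refl (x : rooted_perm) (l : int) : rp_dom x l -> rp_le x l l.
Proof. by move=> xl; case: (rp_le_total xl xl). Qed.

(** The inverse [rho^-1] lists the positions in increasing order of value, so its pattern event says
    that [rho] ranks the window by the order of [x]. *)
Lemma shifted_pattern_le (s : int) (k : nat) (rho : 'S_k) (x : rooted_perm) :
  shifted_pattern s (rho^-1)%g x -> forall a b : 'I_k,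
  rp_le x (a.+1%:Z + s) (b.+1%:Z + s) <-> (rho a <= rho b)%N.
Proof.
move=> [xD xle] a b.
have D (c : 'I_k) : rp_dom x (c.+1%:Z + s).
  by apply: xD => /=; have := ltn_ord c; lia.
have mono (c e : 'I_k) : (c <= e)%N ->
    rp_le x (((rho^-1)%g c).+1%:Z + s) (((rho^-1)%g e).+1%:Z + s).
  (* The pattern compares consecutive entries only; induction on the upper index chains them. *)
  have [m em] : exists m, e = m :> nat by exists e.
  elim: m e em => [|m IH] e em ce.
    have -> : c = e; [apply: val_inj => /=; lia|exact: rp_le_refl].
  have [ce'|ce'] := eqVneq (c : nat) e.
    by have -> : c = e; [exact: val_inj|exact: rp_le_refl].
  have mk : (m < k)%N by have := ltn_ord e; lia.
  apply: (@rp_le_trans x (((rho^-1)%g (Ordinal mk)).+1%:Z + s)).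
    by apply: IH => //=; lia.
  exact: xle.
split=> [ab|/mono]; last by rewrite !permK.
rewrite leqNgt; apply/negP => /[dup] ba /ltnW/mono; rewrite !permK => ba'.
have := rp_le_anti ab ba' => /addIr [] /val_inj E.
by move: ba; rewrite E ltnn.
Qed.

Lemma shifted_pattern_disj (s : int) (k : nat) (rho tau : 'S_k) x :
  shifted_pattern s (rho^-1)%g x -> shifted_pattern s (tau^-1)%g x ->
  rho = tau.
Proof.
move=> xr xt; apply: eq_perm_le => a b; apply/idP/idP.
  by move=> /(shifted_pattern_le xr)/(shifted_pattern_le xt).
by move=> /(shifted_pattern_le xt)/(shifted_pattern_le xr).
Qed.

(** Ranking the window by the order of [x] gives [rho]. With [shifted_pattern_disj], the events
    indexed by [rho] partition the rooted permutations whose domain contains the window. *)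
Lemma shifted_pattern_ex (s : int) (k : nat) (x : rooted_perm) :
  [set l : int | 1 + s <= l <= k%:Z + s] `<=` rp_dom x ->
  exists rho : 'S_k, shifted_pattern s (rho^-1)%g x.
Proof.
move=> xD.
have D (c : 'I_k) : rp_dom x (c.+1%:Z + s).
  by apply: xD => /=; have := ltn_ord c; lia.
pose le (a b : 'I_k) := `[< rp_le x (a.+1%:Z + s) (b.+1%:Z + s) >].
have [||| rho le_rho] := @total_order_perm k le.
- move=> a b; have [ab|ba] := rp_le_total (D a) (D b).
    by apply/orP; left; apply/asboolP.
  by apply/orP; right; apply/asboolP.
- move=> a b /andP[/asboolP ab /asboolP ba].
  by have := rp_le_anti ab ba => /addIr [] /val_inj.
- by move=> b a c /asboolP ab /asboolP bc; apply/asboolP/(rp_le_trans ab bc).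
exists rho; split=> // a b ab.
by apply/asboolP; rewrite -/(le _ _) le_rho !permKV ab.
Qed.

(** The shift by [- j.+1] moves the window to [-j, n - 1 - j], which is the domain of
    [of_perm rho j]. The bounds on [h] make it contain [-h, h]. *)
Lemma restr_shifted_pattern (n h : nat) (rho : 'S_n) (j : 'I_n) x :
  shifted_pattern (- j.+1%:Z) (rho^-1)%g x ->
  (h <= j)%N -> (h + j < n)%N -> restr h (of_perm rho j) = restr h x.
Proof.
move=> xr hj hn.
have win l : - h%:Z <= l <= h%:Z ->
    exists2 a : 'I_n, l + (j : nat)%:Z = (a : nat)%:Z & l = a.+1%:Z - j.+1%:Z.
  move=> lh; have [|a la] := (of_perm_domP j l).1.
    by rewrite /of_perm_dom/=; lia.
  by exists a => //; lia.
have E : restr_dom h (of_perm rho j) = restr_dom h x.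
  apply/seteqP; split=> l [_ lh]; split=> //; have [a la la'] := win l lh.
    by rewrite la'; apply: (proj1 xr) => /=; have := ltn_ord a; lia.
  by apply/of_perm_domP; exists a.
apply: rooted_permP => //=.
apply/funext => l; apply/funext => m; apply/propext; rewrite /restr_le E.
split=> -[xl xm lm]; split=> //;
  have [a la la'] := win l xl.2; have [b mb mb'] := win m xm.2.
  case: lm => a' [b'] [la2 mb2]; rewrite la' mb' shifted_pattern_le; last exact: xr.
  have -> : a' = a by apply: val_inj => /=; lia.
  by have -> : b' = b by apply: val_inj => /=; lia.
exists a, b; split=> //; move: lm; rewrite la' mb' => ?.
exact/(shifted_pattern_le xr).
Qed.

(** * The local topology *)

Lemma local_dist_lt_restr (R : realType) (h : nat) (x y : rooted_perm) :
  local_dist R x y < 2 `^ (- h%:R) -> restr h x = restr h y.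
Proof.
move=> xy; apply: (@agreement_restr R); rewrite ltNge; apply/negP => hxy.
move: xy; rewrite /local_dist; have := agreement_ge0 R x y.
move: hxy; case: (agreement R x y) => [s| |] //.
by rewrite lee_fin => sh _; apply/negP; rewrite -leNgt ler_powR ?ler1n// lerN2.
Qed.

Lemma restr_local_dist_le (R : realType) (h : nat) (x y : rooted_perm) :
  (0 < h)%N -> restr h x = restr h y -> local_dist R x y <= 2 `^ (- h%:R).
Proof.
move=> h0 xy; have : (h%:R%:E <= agreement R x y)%E.
  by apply: ereal_sup_ubound; right; exists h.
rewrite /local_dist; case: (agreement R x y) => [s| |] //.
by rewrite lee_fin => hs; rewrite ler_powR ?ler1n// lerN2.
Qed.

Lemma cvg_restr (R : realType) (u : nat -> rperm R) (x : rperm R) :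
  (forall h, \forall n \near \oo, restr h (u n) = restr h x) ->
  u @ \oo --> x.
Proof.
move=> ux; apply/cvg_ballP => e e0.
have [h h0 he] : exists2 h : nat, (0 < h)%N & (2 : R) `^ (- h%:R) < e.
  (* Any [h] above 1/e works, because 2^h > h. *)
  exists (Num.truncn e^-1).+1 => //.
  rewrite powRN powR_mulrn// invf_plt ?posrE ?exprn_gt0//.
  apply: (lt_trans (truncnS_gt _)).
  by rewrite -natrX ltr_nat ltn_expl.
near=> n; rewrite ballEmdist/=; apply: le_lt_trans he.
apply: restr_local_dist_le => //; apply/esym; near: n; exact: ux.
Unshelve. all: by end_near. Qed.

(** Membership depends only on the order on [1 + s, k + s], which lies within radius |s| + k of the
    root. It is therefore constant on small balls. This makes pattern events Borel. *)
Lemma shifted_pattern_open (R : realType) (s : int) (k : nat) (pi : 'S_k) :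
  open (shifted_pattern s pi : set (rperm R)).
Proof.
rewrite openE => x [xD xle]; rewrite /interior.
pose h := (`|s| + k)%N.
apply/nbhs_ballP; exists ((2 : R) `^ (- h%:R)) => /=; first exact: powR_gt0.
move=> y; rewrite ballEmdist/= => /local_dist_lt_restr xy.
split=> [l ls|a b ab].
  have /(congr1 (@^~ l)) := congr1 rp_dom xy; rewrite /= /restr_dom => E.
  suff [] : (rp_dom y `&` [set l | - h%:Z <= l <= h%:Z]) l by [].
  by rewrite -E; split; [exact: xD|rewrite /= /h; move: ls => /=; lia].
set l := (X in rp_le y X _); set m := (X in rp_le y _ X).
have lh : - h%:Z <= l <= h%:Z by rewrite /l /h; have := ltn_ord (pi a); lia.
have mh : - h%:Z <= m <= h%:Z by rewrite /m /h; have := ltn_ord (pi b); lia.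
have /(congr1 (fun r => r l m)) := congr1 rp_le xy; rewrite /= => E.
suff [] : restr_le h y l m by [].
rewrite -E; have lm := xle _ _ ab; have [xl xm] := rp_le_dom lm.
by split.
Qed.

(** * Finite sums of indicators, averages over roots, Borel measurability *)

Section indicators.
Context (R : realType) (d : measure_display) (T : measurableType d).
Context (P : probability T R) (I : finType) (c : I -> R) (A : I -> set T).

Lemma sum_indic_disj (i : I) (w : T) : A i w ->
  (forall j, A j w -> j = i) -> \sum_j c j * \1_(A j) w = c i.
Proof.
move=> Ai uA; rewrite (bigD1 i)//= big1 ?addr0 => [|j ji].
  by rewrite indicE mem_set// mulr1.
rewrite indicE memNset ?mulr0// => /uA ij.
by rewrite ij eqxx in ji.
Qed.

Hypothesis mA : forall i, measurable (A i).

Lemma measurable_sum_indic : measurable_fun setT (fun w => \sum_i c i * \1_(A i) w).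
Proof.
by apply: measurable_sum => i; exact: measurable_funM.
Qed.

Lemma expectation_sum_indic :
  ('E_P[(fun w => \sum_i c i * \1_(A i) w)%R] =
    (\sum_i c i * fine (P (A i)))%R%:E)%E.
Proof.
rewrite expectation.unlock; under eq_integral do rewrite -sumEFin.
rewrite integral_sum//; last first.
  move=> i; under eq_fun do rewrite EFinM.
  by apply: integrableZl => //; exact: integrable_indic.
rewrite -sumEFin; apply: eq_bigr => i _; under eq_integral do rewrite EFinM.
rewrite integralZl//; last exact: integrable_indic.
by rewrite integral_indic// setIT EFinM fineK// fin_num_measure.
Qed.

End indicators.

(** At most 2h indices lie within [h] of an end, each costing at most [M]; division by n + 1 makes
    their share vanish. *)
Lemma cvg_mean_interior (R : realType) (a : forall n, 'I_n.+1 -> R) (L M : R) :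
  (forall n j, `|a n j - L| <= M) ->
  (forall e : R, 0 < e -> exists h : nat, forall n (j : 'I_n.+1),
    (h <= j)%N -> (h + j <= n)%N -> `|a n j - L| <= e) ->
  n.+1%:R^-1 * \sum_j a n j @[n --> \oo] --> L.
Proof.
move=> aM aL; have M0 : 0 <= M := le_trans (normr_ge0 _) (aM 0%N ord0).
apply/cvgrPdist_le => e e0.
have [h ah] := aL _ (divr_gt0 e0 (ltr0Sn R 1)).
near=> n.
have hn : (h <= n.+1)%N by rewrite leqW//; near: n; exists h.
have lt_sum : \sum_(j < n.+1) (j < h)%N%:R = h%:R :> R.
  rewrite -natr_sum -[in RHS](card_ord_ltn hn) cardsE -sum1_card [in RHS]big_mkcond/=.
  by congr _%:R; apply: eq_bigr => j _; rewrite unfold_in; case: leqP.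
have -> : L = n.+1%:R^-1 * \sum_(j < n.+1) L.
  by rewrite sumr_const card_ord -[L *+ _]mulr_natl mulKf.
rewrite -mulrBr -sumrB normrM ger0_norm// -ler_pdivlMl ?invr_gt0// invrK.
apply: le_trans (ler_norm_sum _ _ _) _.
(* The majorant charges e/2 to every index and [M] to those near an end; [rev_ord j] is n - j, the
   distance to the right end. *)
apply: (@le_trans _ _ (\sum_(j < n.+1)
    (e / 2 + M * ((j < h)%N%:R + (rev_ord j < h)%N%:R)))).
  apply: ler_sum => j _; rewrite distrC.
  have [jh|hj] := ltnP j h.
    rewrite (le_trans (aM _ _))// -[leLHS]add0r lerD//; first by rewrite divr_ge0// ltW.
    by rewrite ler_peMr// lerDl.
  have [jn|nj] := ltnP (rev_ord j) h.
    by rewrite (le_trans (aM _ _))// add0r mulr1 lerDr divr_ge0// ltW.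
  rewrite addr0 mulr0 addr0 ah//.
  by move: nj => /=; have := ltn_ord j; lia.
rewrite big_split/= sumr_const card_ord -mulr_sumr big_split/= lt_sum.
have <- : \sum_(j < n.+1) (j < h)%N%:R =
    \sum_(j < n.+1) (rev_ord j < h)%N%:R :> R by rewrite (reindex_inj rev_ord_inj).
rewrite lt_sum.
(* For such [n] the end terms total at most n e/2, the other half of the allowed error. *)
have : (M * (h%:R + h%:R)) / (e / 2) <= n%:R.
  near: n; exists (Num.truncn (M * (h%:R + h%:R) / (e / 2))).+1 => // n /= hn.
  by rewrite ltW// (lt_le_trans (truncnS_gt _))// ler_nat.
rewrite ler_pdivrMr ?divr_gt0// => nM.
rewrite -[(e / 2) *+ _]mulr_natl -natr1. lra.
Unshelve. all: by end_near. Qed.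

Lemma continuous_borel_measurable (R : realType) (f : rperm R -> R) :
  continuous f -> measurable_fun [set: borel_rperm R] (f : borel_rperm R -> R).
Proof.
move=> /continuousP cf; apply: (measurability _ (RGenOpens.measurableE R)).
move=> _ [_ [a [b ->] <-]]; rewrite setTI.
apply: sub_sigma_algebra; exact/cf/interval_open.
Qed.

(** * The permutation X seen through the windows [-j, n - j] *)

Section window.
Context (R : realType) (d : measure_display) (Omega : measurableType d).
Context (P : probability Omega R) (X : {RV P >-> borel_rperm R}).
Hypothesis X_Z : {ae P, forall w, rp_dom (X w) = [set: int]}.

Lemma measurable_shifted_pattern (s : int) (k : nat) (pi : 'S_k) :
  measurable (X @^-1` shifted_pattern s pi).
Proof.
apply: (measurable_funPTI X); apply: sub_sigma_algebra.
exact: shifted_pattern_open.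
Qed.

Lemma sum_shifted_pattern (s : int) (k : nat) (c : 'S_k -> R) (w : Omega) :
  rp_dom (X w) = [set: int] ->
  exists2 rho : 'S_k, shifted_pattern s (rho^-1)%g (X w) &
  \sum_tau c tau * \1_(X @^-1` shifted_pattern s (tau^-1)%g) w = c rho.
Proof.
move=> XZ; have [rho Xrho] : exists rho : 'S_k, shifted_pattern s (rho^-1)%g (X w).
  by apply: shifted_pattern_ex; rewrite XZ.
exists rho => //; apply: sum_indic_disj => // tau Xtau.
exact: shifted_pattern_disj Xtau Xrho.
Qed.

(** Almost surely exactly one pattern event occurs, so the indicators sum to 1; take expectations.
    Thus the prescribed law of the random permutation is a probability. *)
Lemma sum_prob_pattern (k : nat) :
  (\sum_(rho : 'S_k) P (X @^-1` pattern (rho^-1)%g) = 1)%E.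
Proof.
have mX (rho : 'S_k) := measurable_shifted_pattern 0 (rho^-1)%g.
have := expectation_sum_indic P (fun=> 1) mX.
under [X in _ = X%:E]eq_bigr do rewrite mul1r.
rewrite -sumEFin; under [X in _ = X]eq_bigr do rewrite fineK ?fin_num_measure//.
move=> <-; rewrite -[RHS](expectation_cst P 1) !expectation.unlock.
apply: ae_eq_integral => //.
  exact/measurable_EFinP/measurable_sum_indic.
  by apply/measurable_EFinP.
apply: filterS X_Z => w XZ _ /=.
by have [rho _ ->] := sum_shifted_pattern 0 (fun _ : 'S_k => 1 : R) XZ.
Qed.

Hypothesis X_shift : shift_invariant P X.
Context (f : rperm R -> R) (M : R).
Hypotheses (f_cont : continuous f) (f_bound : forall x, `|f x| <= M).

(** For [X] with domain Z, this is [f] at the finite rooted permutation cut out of [X] by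
    [-j, n - j]. The sum of indicators gives its measurability and expectation directly. *)
Definition window_fun (n : nat) (j : 'I_n.+1) (w : Omega) : R :=
  \sum_(rho : 'S_n.+1) f (of_perm rho j) *
    \1_(X @^-1` shifted_pattern (- j.+1%:Z) (rho^-1)%g) w.

(** The mean of [f] at the random permutation of size n + 1 rooted at the fixed index [j]. The
    unshifted pattern appears because the law does not depend on [j]. *)
Definition window_mean (n : nat) (j : 'I_n.+1) : R :=
  \sum_(rho : 'S_n.+1) f (of_perm rho j) *
    fine (P (X @^-1` pattern (rho^-1)%g)).

Lemma window_funE (n : nat) (j : 'I_n.+1) (w : Omega) :
  rp_dom (X w) = [set: int] ->
  exists2 x : rperm R, window_fun j w = f x &
  forall h, (h <= j)%N -> (h + j <= n)%N -> restr h x = restr h (X w).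
Proof.
move=> /(sum_shifted_pattern (- j.+1%:Z) (fun rho : 'S_n.+1 => f (of_perm rho j))).
move=> [rho Xrho E]; exists (of_perm rho j) => // h hj hn.
exact: restr_shifted_pattern Xrho hj _.
Qed.

(** Shift-invariance enters here: it replaces the shift [- j.+1] by 0 in every pattern
    probability. *)
Lemma expectation_window_fun (n : nat) (j : 'I_n.+1) :
  ('E_P[window_fun j] = (window_mean j)%:E)%E.
Proof.
rewrite expectation_sum_indic => [|rho]; last exact: measurable_shifted_pattern.
by congr (_%:E)%E; apply: eq_bigr => rho _; rewrite X_shift.
Qed.

Lemma measurable_comp_RV : measurable_fun setT (f \o X).
Proof.
apply: (@measurableT_comp _ _ _ _ _ _ (f : borel_rperm R -> R)).
  exact: continuous_borel_measurable.
exact: measurable_funP.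
Qed.

Lemma integrable_comp_RV : P.-integrable setT (EFin \o (f \o X)).
Proof.
apply: measurable_bounded_integrable => //.
- by apply: le_lt_trans (probability_le1 P measurableT) _; exact: ltry.
- exact: measurable_comp_RV.
exists M; split; first exact: num_real.
by move=> x Mx w _ /=; rewrite (le_trans (f_bound _))// ltW.
Qed.

Lemma expectation_comp_RVK : ((fine 'E_P[f \o X])%:E = 'E_P[f \o X])%E.
Proof.
by rewrite fineK// expectation.unlock; exact/integrable_fin_num/integrable_comp_RV.
Qed.

(** Dominated convergence with the constant [M]: the [h]-th window contains [-h, h], so the windowed
    permutations converge to [X] almost surely, and [f] is continuous. *)
Lemma window_mean_cvg (N : nat -> nat) (J : forall h, 'I_(N h).+1) :
  (forall h, (h <= J h)%N /\ (h + J h <= N h)%N) ->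
  (window_mean (J h))%:E @[h --> \oo] --> ('E_P[f \o X])%E.
Proof.
move=> NJ; rewrite expectation.unlock.
have -> : (fun h => (window_mean (J h))%:E) =
    (fun h => \int[P]_w (window_fun (J h) w)%:E)%E.
  by apply/funext => h; rewrite -expectation_window_fun expectation.unlock.
have [] // := @dominated_convergence _ _ _ P setT measurableT
  (fun h w => (window_fun (J h) w)%:E) (EFin \o (f \o X)) (EFin \o cst M).
- move=> h; apply/measurable_EFinP/measurable_sum_indic => rho.
  exact: measurable_shifted_pattern.
- exact/measurable_EFinP/measurable_comp_RV.
- apply: filterS X_Z => w XZ _.
  have /choice[u uP] : forall h, exists x : rperm R, window_fun (J h) w = f x /\
      forall k, (k <= h)%N -> restr k x = restr k (X w).
    move=> h; have [x Ex xP] := window_funE (J h) XZ; have [hJ hN] := NJ h.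
    by exists x; split=> // k kh; apply: xP; lia.
  have -> : (fun h => (window_fun (J h) w)%:E) = (fun h => (f (u h))%:E).
    by apply/funext => h; rewrite (uP h).1.
  apply: cvg_EFin; first by apply: nearW.
  apply: (@continuous_cvg _ (rperm R) R _ _ u f (X w)); first exact: f_cont.
  (* From index [k] on, the window covers [-k, k], so the restrictions agree. *)
  apply: cvg_restr => k; exists k => // h /= kh.
  exact: (uP h).2.
- exact: finite_measure_integrable_cst.
apply: filterS X_Z => w XZ h _ /=; rewrite lee_fin.
by have [x -> _] := window_funE (J h) XZ.
Qed.

Lemma window_mean_unif (e : R) : 0 < e -> exists h : nat,
  forall n (j : 'I_n.+1), (h <= j)%N -> (h + j <= n)%N ->
  `|window_mean j - fine ('E_P[f \o X])%E| <= e.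
Proof.
move=> e0; apply: contrapT => noh.
have /choice[NJ NJP] : forall h : nat, exists t : {n & 'I_n.+1},
    [/\ (h <= projT2 t)%N, (h + projT2 t <= projT1 t)%N &
      e < `|window_mean (projT2 t) - fine ('E_P[f \o X])%E|].
  move=> h; apply: contrapT => noj; apply: noh; exists h => n j hj hn.
  rewrite leNgt; apply/negP => lt_e; apply: noj.
  by exists (existT _ n j).
have := @window_mean_cvg (fun h => projT1 (NJ h)) (fun h => projT2 (NJ h)).
have NJ2 h : (h <= projT2 (NJ h))%N /\ (h + projT2 (NJ h) <= projT1 (NJ h))%N.
  by have [] := NJP h.
move=> /(_ NJ2); rewrite -expectation_comp_RVK => /fine_cvgP[_].
(* Convergence along the chosen bad windows puts one of them within [e] of the limit, against its
   choice. *)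
move=> /cvgrPdist_le/(_ _ e0)[h _ /(_ h (leqnn h))/=].
by rewrite distrC leNgt; have [_ _ ->] := NJP h.
Qed.

(** A weighted average of values of [f], with weights summing to 1 by [sum_prob_pattern]. *)
Lemma window_mean_bound (n : nat) (j : 'I_n.+1) : `|window_mean j| <= M.
Proof.
apply: le_trans (ler_norm_sum _ _ _) _.
apply: (@le_trans _ _ (\sum_(rho : 'S_n.+1)
    M * fine (P (X @^-1` pattern (rho^-1)%g)))).
  apply: ler_sum => rho _; rewrite normrM [X in _ * X]ger0_norm ?fine_ge0//.
  by rewrite ler_wpM2r ?fine_ge0.
rewrite -mulr_sumr (_ : \sum_rho _ = 1) ?mulr1//.
apply: EFin_inj; rewrite -sumEFin -(sum_prob_pattern n.+1).
apply: eq_bigr => rho _; rewrite fineK// fin_num_measure//.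
exact: (measurable_shifted_pattern 0).
Qed.

End window.

(** * Uniform independent roots and the conclusion *)

Lemma expectation_rooted (R : realType) (d : measure_display)
    (T : measurableType d) (Q : probability T R) (n : nat)
    (sigma : T -> 'S_n.+1) (i : T -> 'I_n.+1) (g : 'S_n.+1 -> 'I_n.+1 -> R) :
  discrete_measurable_fun sigma -> discrete_measurable_fun i ->
  uniform_index Q i -> discrete_independent Q sigma i ->
  ('E_Q[(fun w => g (sigma w) (i w))%R] =
   (n.+1%:R^-1 * \sum_j \sum_rho g rho j * fine (Q (sigma @^-1` [set rho])))%R%:E)%E.
Proof.
move=> msigma mi iunif indep.
(* These joint events partition the space; independence and uniformity give each the weight 1/(n +
   1) times the law of [sigma]. *)
pose A (t : 'I_n.+1 * 'S_n.+1) := sigma @^-1` [set t.2] `&` i @^-1` [set t.1].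
have mA t : measurable (A t) by apply: measurableI; [exact: msigma|exact: mi].
have -> : (fun w => g (sigma w) (i w)) =
    (fun w => \sum_t g t.2 t.1 * \1_(A t) w).
  apply/funext => w; rewrite (@sum_indic_disj _ _ _ _ _ _ (i w, sigma w))//.
  by move=> [j rho] [/= -> ->].
rewrite expectation_sum_indic//; congr (_%:E)%E.
rewrite pair_bigA mulr_sumr; apply: eq_bigr => -[j rho] _ /=.
by rewrite indep iunif fineM ?fin_num_measure//= mulrA mulrC.
Qed.

Theorem theorem2p45 (R : realType)
  (d : measure_display) (Omega : measurableType d) (P : probability Omega R)
  (X : {RV P >-> borel_rperm R})
  (X_Z : {ae P, forall w, rp_dom (X w) = [set: int]})
  (X_shift : shift_invariant P X) :
  (forall n : nat,
    (\sum_(rho : 'S_n.+1) P (X @^-1` pattern (rho^-1)%g))%E = 1%E) /\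
  (forall (d' : nat -> measure_display)
    (Omega' : forall n, measurableType (d' n))
    (Q : forall n, probability (Omega' n) R)
    (sigma : forall n, Omega' n -> 'S_n.+1)
    (i : forall n, Omega' n -> 'I_n.+1),
    (forall n, discrete_measurable_fun (sigma n)) ->
    (forall n, discrete_measurable_fun (i n)) ->
    (forall n (rho : 'S_n.+1),
      Q n (sigma n @^-1` [set rho]) = P (X @^-1` pattern (rho^-1)%g)) ->
    (forall n, uniform_index (Q n) (i n)) ->
    (forall n, discrete_independent (Q n) (sigma n) (i n)) ->
    annealed_BS_cvg Q sigma i P X).
Proof.
split=> [n|d' Omega' Q sigma i msigma mi sigma_law i_unif indep f f_cont].
  exact: sum_prob_pattern.
move=> [M0 [_ /(_ (`|M0| + 1))]].
(* Boundedness yields a bound only for reals strictly above [M0]; [|M0| + 1] is such a real. *)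
have M0lt : M0 < `|M0| + 1 by rewrite (le_lt_trans (ler_norm _))// ltrDl.
move=> /(_ M0lt) f_bound; set M := `|M0| + 1 in f_bound.
have {}f_bound x : `|f x| <= M by exact: f_bound.
have -> : (fun n => 'E_(Q n)[f \o (fun w => of_perm (sigma n w) (i n w))])%E =
    (fun n => (n.+1%:R^-1 * \sum_(j < n.+1) window_mean X f j)%:E).
  apply/funext => n.
  rewrite (expectation_rooted (fun rho j => f (of_perm rho j)))//.
  congr (_ * _)%:E; apply: eq_bigr => j _; apply: eq_bigr => rho _.
  by rewrite sigma_law.
rewrite -(expectation_comp_RVK X f_cont f_bound).
apply: cvg_EFin; first exact: nearW.
(* The uniform deviation bound adds the bound [M] on the means to the absolute value of the
   limit. *)
apply: (@cvg_mean_interior _ _ _ (M + `|fine ('E_P[f \o X])%E|)) => [n j|e e0].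
  rewrite (le_trans (ler_normB _ _))// lerD2r.
  exact: (window_mean_bound X_Z f_bound).
exact: (window_mean_unif X_Z X_shift f_cont f_bound).
Qed.
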